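(* Let $G=[g_1,g_2,\ldots]$ be a transcendental semigroup. If all the components of $F(G)$ are bounded and simply connected, then the Julia set is connected in $\mathbb{C}$, i.e. $J(G)\cap\mathbb{C}=\mathbb{C}\setminus F(G)$ is connected.
   Context: A transcendental semigroup $G=[g_1,g_2,\ldots]$ is the set of all finite compositions (of length at least one) of members of a countable (finite or infinite) family $\{g_1,g_2,\ldots\}$ of transcendental entire functions. The Fatou set $F(G)$ is the largest open subset of $\mathbb{C}$ on which the family $G$ is normal (every sequence in $G$ has a subsequence converging locally uniformly to a holomorphic function or to $\infty$). The Julia set is $J(G)=\widetilde{\mathbb{C}}\setminus F(G)$, where $\widetilde{\mathbb{C}}=\mathbb{C}\cup\{\infty\}$ is the Riemann sphere; when regarded in $\mathbb{C}$ it means $\mathbb{C}\setminus F(G)$. *)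

(* Defs.v *)
From HB Require Import structures.
From mathcomp Require Import all_boot all_order all_algebra.
From mathcomp Require Import all_classical all_reals all_analysis.
From mathcomp Require Import complex.

Set Implicit Arguments.
Unset Strict Implicit.
Unset Printing Implicit Defensive.

Import Order.TTheory GRing.Theory Num.Theory.
Import numFieldNormedType.Exports.

Local Open Scope classical_set_scope.
Local Open Scope ring_scope.
Local Open Scope complex_scope.
(* R[i] carries no topology of its own in the libraries; giving the alias the
   type numClosedFieldType makes it inherit, through numFieldNormedType.Exports,
   the topology and the C-normed module structure given by the modulus (which is
   C-valued, so a real bound has to be injected with %:C). *)
Definition C (R : realType) : numClosedFieldType := R[i].

Inductive comp_semigroup (T : Type) (S : set (T -> T)) : (T -> T) -> Prop :=
| comp_semigroup_gen g : S g -> comp_semigroup S g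
| comp_semigroup_comp g h :
    comp_semigroup S g -> comp_semigroup S h -> comp_semigroup S (g \o h).

Section TranscendentalSemigroups.
Context {R : realType}.
Local Notation C := (C R).
Implicit Types (U : set C) (f : C -> C) (s : nat -> C -> C)
  (G : set (C -> C)).

(* The base field of the derivative is C, so this is complex
   differentiability. *)
Definition holomorphic_on U f := forall z, U z -> derivable f z 1.

Definition transcendental_entire f :=
  holomorphic_on setT f /\ ~ (exists p : {poly C}, forall z, f z = p.[z]).

Definition transcendental_semigroup G :=
  exists S : set (C -> C),
    [/\ S !=set0, countable S, (forall g, S g -> transcendental_entire g) &
        G = comp_semigroup S].

Definition cvg_locally_uniformly U s f :=
  forall z, U z -> exists2 V, nbhs z V & {uniform V, s @ \oo --> f}.

Definition cvg_locally_uniformly_infty U s :=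
  forall z, U z -> exists2 V, nbhs z V &
    forall M : R, \forall n \near \oo, forall w, V w -> (M%:C : C) < `|s n w|.

Definition normal_family G U :=
  forall s, (forall n, G (s n)) ->
  exists2 phi : nat -> nat, {homo phi : m n / (m < n)%N} &
    (exists2 f, holomorphic_on U f & cvg_locally_uniformly U (s \o phi) f) \/
    cvg_locally_uniformly_infty U (s \o phi).

(* Normality is a local property: on a disconnected open set the limit may be
   infinite on some components and finite on others.  The largest open set of
   normality is therefore the union of all the open sets U on which G is normal
   in the sense of normal_family, i.e. the set of the points that have a
   neighbourhood on which G is normal. *)
Definition fatou_set G : set C :=
  \bigcup_(U in [set U | open U /\ normal_family G U]) U.

(* The trace of the Julia set in the finite plane. *)
Definition julia_set G : set C := ~` fatou_set G.

Definition path_in U (gamma : R -> C) (x y : C) :=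
  [/\ {within `[0, 1], continuous gamma},
      forall t, t \in `[0, 1] -> U (gamma t), gamma 0 = x & gamma 1 = y].

Definition path_connected U :=
  U !=set0 /\ forall x y, U x -> U y -> exists gamma, path_in U gamma x y.

(* Homotopy relative to the base point; the first variable is the homotopy
   parameter. *)
Definition null_homotopic_in U (gamma : R -> C) (x : C) :=
  exists H : R * R -> C,
    [/\ {within `[0, 1] `*` `[0, 1], continuous H},
        forall a t, a \in `[0, 1] -> t \in `[0, 1] -> U (H (a, t)),
        forall t, t \in `[0, 1] -> H (0, t) = gamma t,
        forall t, t \in `[0, 1] -> H (1, t) = x &
        forall a, a \in `[0, 1] -> H (a, 0) = x /\ H (a, 1) = x].

Definition simply_connected U :=
  path_connected U /\
  forall x gamma, path_in U gamma x x -> null_homotopic_in U gamma x.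

End TranscendentalSemigroups.

(* Main.v *)
Require Import Defs.
From mathcomp Require Import all_boot all_order all_algebra.
From mathcomp Require Import all_classical all_reals all_analysis.
From mathcomp Require Import complex ring lra.
Import Order.TTheory GRing.Theory Num.Theory.
Import numFieldNormedType.Exports.
Local Open Scope classical_set_scope.
Local Open Scope ring_scope.

(* Only the topology of the open set U := F(G) matters.  If the complement of U
   is the disjoint union of two nonempty closed sets A and B, a segment from A
   to B crosses a component V of U whose boundary meets both A and B, so it
   suffices that a bounded simply connected domain V has a connected boundary.
   Circle-valued maps lift to real angles over V and over the plane.
   Let u be 0 on A and 2 pi on B.  The map equal to exp(iu) on V and to 1 off V
   has an angle phi over the plane, and phi - u is constant on the closure of V,
   so that phi takes different values at two boundary points.
   But phi is constant off V: if phi(p) differs from the value of phi far away,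
   the angle of z - p over V can be switched off, using phi, near the part of
   the complement of V where phi = phi(p); this extends (z - p) / |z - p| from a
   large circle to a circle-valued map of the plane, which is impossible.
   A circle-valued map is given by its real and imaginary parts a and b. *)

(** * Angles and clamping *)

Section CircleLifts.
Context {R : realType}.
Implicit Types (a b t x y : R).

Lemma cos1_eq0 x : -1 <= x <= 1 -> cos x = 1 -> x = 0.
Proof.
have pi2 := @pi_ge2 R.
wlog x0 : x / 0 <= x => [H hx cx|].
  have [x0|x0] := leP 0 x; first exact: H.
  by apply: oppr_inj; rewrite oppr0; apply: H; rewrite ?cosN //; lra.
move=> hx cx; apply: (@cos_inj R); rewrite ?in_itv /= ?cos0 //; lra.
Qed.

(** The true gap is [2 * pi]. This weaker bound follows from the injectivity of [cos] on [0, pi] and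
    [pi >= 2], and it leaves room for the thresholds 1/2, 1 and 3/2 of the glueing below. *)
Lemma cos1_gt1 x : cos x = 1 -> 0 < x -> 3 / 2 < x.
Proof.
move=> cx x0; rewrite ltNge; apply/negP => x1.
have pi2 := @pi_ge2 R.
suff : x = 0 by move=> xE; rewrite xE ltxx in x0.
apply: (@cos_inj R); rewrite ?in_itv /= ?cos0 //; lra.
Qed.

Lemma cos1_sin0 x : cos x = 1 -> sin x = 0.
Proof.
move=> cx; have := cos2Dsin2 x; rewrite cx expr1n => h.
by apply/eqP; rewrite -sqrf_eq0; apply/eqP; lra.
Qed.

Lemma eq_angle_cos1 x y : cos x = cos y -> sin x = sin y -> cos (x - y) = 1.
Proof. by move=> cE sE; rewrite cosB cE sE -!expr2 cos2Dsin2. Qed.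

(* Here and below [cos t = 1] encodes [t \in 2 pi Z]; a continuous function with
   such values is constant on connected sets. *)
Lemma cos1_const (T : topologicalType) (X : set T) (d : T -> R) (u v : T) :
  connected X -> {within X, continuous d} -> (forall w, X w -> cos (d w) = 1) ->
  X u -> X v -> d u = d v.
Proof.
wlog uv : u v / d u <= d v.
  move=> H cX cd h Xu Xv; have [uv|/ltW uv] := leP (d u) (d v); first exact: H.
  by apply/esym; exact: H.
move=> cX cd h Xu Xv; apply/eqP; rewrite eq_le uv /= leNgt; apply/negP => luv.
have /connected_intervalP := connected_continuous_connected cX cd.
(* The image of [X] is an interval, so it contains [m], which exceeds [d u] by at most 1: too little
   for two angles of cosine 1. *)
pose m := Num.min (d u + 1) (d v).
have [m1 m2] : m <= d u + 1 /\ m <= d v by split; rewrite ge_min lexx ?orbT.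
have m3 : d u < m by rewrite lt_min luv ltrDl ltr01.
move=> /(_ (d u) (d v)) H.
have [] := H _ _ m; [by exists u|by exists v|by rewrite (ltW m3) m2|].
move=> w Xw wm.
have : m - d u = 0.
  apply: cos1_eq0; first by apply/andP; split; lra.
  rewrite -wm cosB !h // (cos1_sin0 _ (h _ Xw)); ring.
by move=> e; lra.
Qed.

Lemma unit_circle_angle a b : a ^+ 2 + b ^+ 2 = 1 ->
  exists t, a = cos t /\ b = sin t.
Proof.
move=> h; have ha : -1 <= a <= 1.
  by apply/andP; split; have := sqr_ge0 b; nra.
have aC : cos (acos a) = a by apply: acosK; rewrite in_itv.
have bE : Num.sqrt (1 - a ^+ 2) = `|b| by rewrite -h addrC addKr sqrtr_sqr.
have [b0|b0] := leP 0 b.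
  by exists (acos a); rewrite aC sin_acos // bE ger0_norm.
by exists (- acos a); rewrite cosN aC sinN sin_acos // bE ltr0_norm // opprK.
Qed.

(** Rotating [(a, b)] by [- t] gives a point of the right half circle, whose angle is the arcsine of
    its second coordinate. *)
Lemma angle_step t a b : a ^+ 2 + b ^+ 2 = 1 -> 0 < cos t * a + sin t * b ->
  a = cos (t + asin (cos t * b - sin t * a)) /\
  b = sin (t + asin (cos t * b - sin t * a)).
Proof.
move=> h; set p := cos t * a + _; set q := cos t * b - _ => p0.
have cs := cos2Dsin2 t.
have pq : p ^+ 2 + q ^+ 2 = 1.
  transitivity ((cos t ^+ 2 + sin t ^+ 2) * (a ^+ 2 + b ^+ 2)).
    by rewrite /p /q; ring.
  by rewrite h cs mulr1.
have q1 : -1 <= q <= 1 by apply/andP; split; have := sqr_ge0 p; nra.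
have sq : sin (asin q) = q by apply: asinK; rewrite in_itv.
have cq : cos (asin q) = p.
  by rewrite cos_asin // -pq addrK sqrtr_sqr gtr0_norm.
rewrite cosD sinD sq cq.
have aE : a = (cos t ^+ 2 + sin t ^+ 2) * a by rewrite cs mul1r.
have bE : b = (cos t ^+ 2 + sin t ^+ 2) * b by rewrite cs mul1r.
by split; [rewrite {1}aE|rewrite {1}bE]; rewrite /p /q; ring.
Qed.

Definition clamp t := Num.max 0 (Num.min 1 t).

Lemma clamp_continuous : continuous clamp.
Proof.
move=> t; apply: continuous_max; first exact: cvg_cst.
by apply: continuous_min; [exact: cvg_cst|exact: cvg_id].
Qed.

Lemma clamp_itv t : 0 <= clamp t <= 1.
Proof.
rewrite /clamp le_max lexx /= ge_max ler01 /= ge_min lexx //.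
Qed.

Lemma clamp_id t : 0 <= t <= 1 -> clamp t = t.
Proof. by move=> /andP[t0 t1]; rewrite /clamp min_r // max_r. Qed.

Lemma clamp_le0 t : t <= 0 -> clamp t = 0.
Proof. by move=> t0; rewrite /clamp max_l // ge_min t0 orbT. Qed.

Lemma clamp_ge1 t : 1 <= t -> clamp t = 1.
Proof. by move=> t1; rewrite /clamp min_l // max_r // ler01. Qed.

Lemma clamp0 : clamp 0 = 0.
Proof. exact: clamp_le0. Qed.

Lemma clamp1 : clamp 1 = 1.
Proof. exact: clamp_ge1. Qed.

End CircleLifts.

(** * Lifting over a square *)

Section SquareLift.
Context {R : realType}.

Lemma cvg_to_pair {I : Type} {U V : topologicalType} {F : set_system I}
    {FF : Filter F} (f : I -> U) (g : I -> V) (y : U) (z : V) :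
  f @ F --> y -> g @ F --> z -> (fun i => (f i, g i)) @ F --> (y, z).
Proof. by move=> cf cg; apply: cvg_pair. Qed.

Lemma continuous_at_add (T : topologicalType) (f g : T -> R) (t : T) :
  {for t, continuous f} -> {for t, continuous g} ->
  {for t, continuous (fun u => f u + g u)}.
Proof. exact: continuousD. Qed.

Lemma continuous_at_sub (T : topologicalType) (f g : T -> R) (t : T) :
  {for t, continuous f} -> {for t, continuous g} ->
  {for t, continuous (fun u => f u - g u)}.
Proof. exact: continuousB. Qed.

Lemma continuous_at_mul (T : topologicalType) (f g : T -> R) (t : T) :
  {for t, continuous f} -> {for t, continuous g} ->
  {for t, continuous (fun u => f u * g u)}.
Proof. exact: continuousM. Qed.

Lemma continuous_at_cst (T U : topologicalType) (k : U) (t : T) :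
  {for t, continuous (fun=> k)}.
Proof. exact: cvg_cst. Qed.

Lemma continuous_at_pair (T U V : topologicalType) (f : T -> U) (g : T -> V)
    (t : T) : {for t, continuous f} -> {for t, continuous g} ->
  {for t, continuous (fun u => (f u, g u))}.
Proof. exact: cvg_to_pair. Qed.

(** For a step of length 0 the expression is [a ^+ 2 + b ^+ 2 = 1]. By compactness of the cube of
    the parameters [(l, (x, y))], one small positive step keeps it positive everywhere. *)
Lemma small_steps (a b : R * R -> R) : continuous a -> continuous b ->
  (forall z, a z ^+ 2 + b z ^+ 2 = 1) ->
  exists n : nat, forall l x y : R, 0 <= l <= 1 -> 0 <= x <= 1 -> 0 <= y <= 1 ->
    0 < a (l * x, l * y) * a ((l + n.+1%:R^-1) * x, (l + n.+1%:R^-1) * y) +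
        b (l * x, l * y) * b ((l + n.+1%:R^-1) * x, (l + n.+1%:R^-1) * y).
Proof.
move=> ca cb ab.
pose g (q : R * (R * R) * R) := (q.1.1 * q.1.2.1, q.1.1 * q.1.2.2).
pose h (q : R * (R * R) * R) :=
  ((q.1.1 + q.2) * q.1.2.1, (q.1.1 + q.2) * q.1.2.2).
pose Phi q := a (g q) * a (h q) + b (g q) * b (h q).
have c1 : continuous (fun q : R * (R * R) * R => q.1.1).
  by move=> q; apply: (@continuous_comp _ _ _ fst fst); exact: cvg_fst.
have c12 : continuous (fun q : R * (R * R) * R => q.1.2).
  by move=> q; apply: (@continuous_comp _ _ _ fst snd);
    [exact: cvg_fst|exact: cvg_snd].
have c121 : continuous (fun q : R * (R * R) * R => q.1.2.1).
  by move=> q; apply: (@continuous_comp _ _ _ (fun q => q.1.2) fst);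
    [exact: c12|exact: cvg_fst].
have c122 : continuous (fun q : R * (R * R) * R => q.1.2.2).
  by move=> q; apply: (@continuous_comp _ _ _ (fun q => q.1.2) snd);
    [exact: c12|exact: cvg_snd].
have c2 : continuous (fun q : R * (R * R) * R => q.1.1 + q.2).
  by move=> q; apply: cvgD; [exact: c1|exact: cvg_snd].
have cg : continuous g.
  by move=> q; rewrite /continuous_at /g; apply: cvg_to_pair; apply: cvgM;
    [exact: c1|exact: c121|exact: c1|exact: c122].
have ch : continuous h.
  by move=> q; rewrite /continuous_at /h; apply: cvg_to_pair; apply: cvgM;
    [exact: c2|exact: c121|exact: c2|exact: c122].
have cPhi : continuous Phi.
  move=> q; apply: cvgD; apply: cvgM.
  - exact: (continuous_comp (cg q) (ca _)).
  - exact: (continuous_comp (ch q) (ca _)).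
  - exact: (continuous_comp (cg q) (cb _)).
  - exact: (continuous_comp (ch q) (cb _)).
have cK : compact (`[0, 1] `*` (`[0, 1] `*` `[0, 1]) : set (R * (R * R))).
  by do 2?[apply: compact_setX]; exact: segment_compact.
move/compact_near_coveringP : cK.
move=> /(_ nat \oo (fun n q => 0 < Phi (q, n.+1%:R^-1)) _).
case.
  move=> q _.
  have : \forall p \near (q, 0 : R), 0 < Phi p.
    apply: (cPhi (q, 0) [set r | 0 < r]); apply: lt_nbhsr.
    by rewrite /Phi /g /h /= addr0 -!expr2 ab ltr01.
  have : (fun w : R * (R * R) * nat => (w.1, w.2.+1%:R^-1 : R)) @
      filter_prod (nbhs q) \oo --> (q, 0 : R).
    apply: cvg_to_pair; first exact: cvg_fst.
    by apply: (cvg_comp snd (@harmonic R));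
      [exact: cvg_snd|exact: cvg_harmonic].
  by move=> H /H.
move=> n _ /(_ n (leqnn n)) H; exists n => l x y hl hx hy.
exact: (H (l, (x, y))).
Qed.

(* Along the ray from the origin to [(x, y)], consecutive values of [(a, b)] make
   an angle less than [pi / 2], so that [th] is a sum of arcsines. *)
Lemma square_lift (a b : R * R -> R) : continuous a -> continuous b ->
  (forall z, a z ^+ 2 + b z ^+ 2 = 1) ->
  exists2 th : R * R -> R, continuous th & forall x y,
    0 <= x <= 1 -> 0 <= y <= 1 -> a (x, y) = cos (th (x, y)) /\
                                  b (x, y) = sin (th (x, y)).
Proof.
move=> ca cb ab; have [n hn] := small_steps _ _ ca cb ab.
pose s (k : nat) : R := k%:R / n.+1%:R.
pose g k (z : R * R) : R * R := (s k * clamp z.1, s k * clamp z.2).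
have cg k : continuous (g k).
  move=> z; rewrite /continuous_at /g.
  apply: cvg_to_pair; apply: cvgM; try exact: cvg_cst.
    by apply: (@continuous_comp _ _ _ fst clamp);
      [exact: cvg_fst|exact: clamp_continuous].
  by apply: (@continuous_comp _ _ _ snd clamp);
      [exact: cvg_snd|exact: clamp_continuous].
have [th cth thE] : exists2 th : R * R -> R, continuous th & forall z,
    a (g n.+1 z) = cos (th z) /\ b (g n.+1 z) = sin (th z).
  (* Induction on [k <= n.+1]: an angle is found for the points [g k z], at the fraction [k / n.+1]
     of each ray. *)
  have : (n.+1 <= n.+1)%N by [].
  elim: {-2}(n.+1) => [_|k IH kn].
    have [t [tc ts]] := unit_circle_angle _ _ (ab (0, 0)).
    by exists (fun=> t) => [z|z]; [exact: cvg_cst|rewrite /g /s !mul0r].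
  have [th cth thE] := IH (ltnW kn).
  pose q z := cos (th z) * b (g k.+1 z) - sin (th z) * a (g k.+1 z).
  have dot z : 0 < cos (th z) * a (g k.+1 z) + sin (th z) * b (g k.+1 z).
    have [<- <-] := thE z.
    have sk : s k.+1 = s k + n.+1%:R^-1 by rewrite /s -natr1 mulrDl mul1r.
    rewrite /g sk; apply: hn; try exact: clamp_itv.
    by rewrite divr_ge0 //= ler_pdivrMr // mul1r ler_nat ltnW // ltnW.
  have cq : continuous q.
    move=> z; apply: cvgB; apply: cvgM.
    - exact: (continuous_comp (cth z) (@continuous_cos R _)).
    - exact: (continuous_comp (cg k.+1 z) (cb _)).
    - exact: (continuous_comp (cth z) (@continuous_sin R _)).
    - exact: (continuous_comp (cg k.+1 z) (ca _)).
  exists (fun z => th z + asin (q z)).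
    move=> z; apply: cvgD; first exact: cth.
    apply: (continuous_comp (cq z)); apply: continuous_asin.
    (* The rotated point has norm 1 and a positive first coordinate, so [q z] lies strictly between
       -1 and 1, where [asin] is continuous. *)
    have : (cos (th z) * a (g k.+1 z) + sin (th z) * b (g k.+1 z)) ^+ 2 +
        q z ^+ 2 = (cos (th z) ^+ 2 + sin (th z) ^+ 2) *
        (a (g k.+1 z) ^+ 2 + b (g k.+1 z) ^+ 2) by rewrite /q; ring.
    rewrite cos2Dsin2 ab mulr1; move: (dot z).
    set p := _ + _ * b _ => p0 pq.
    have : 0 < p ^+ 2 by rewrite exprn_gt0.
    by move=> p2; apply/andP; split; nra.
  by move=> z; exact: angle_step.
exists th => // x y hx hy; have := thE (x, y).
by rewrite /g /s divff ?pnatr_eq0 // !mul1r /= !clamp_id.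
Qed.

End SquareLift.

(** * Paths and angle increments *)

Section PlaneLifts.
Context {R : realType}.
Local Notation C := (C R).
Implicit Types (X : set C) (p q : R -> C) (x y z w : C) (a b : C -> R).

Definition cmk (s t : R) : C := Complex s t.
Definition re z : R := complex.Re z.
Definition im z : R := complex.Im z.

Lemma cmkK z : cmk (re z) (im z) = z.
Proof. by case: z. Qed.

Lemma re_add z w : re (z + w) = re z + re w.
Proof. by case: z; case: w. Qed.

Lemma im_add z w : im (z + w) = im z + im w.
Proof. by case: z; case: w. Qed.

Lemma re_sub z w : re (z - w) = re z - re w.
Proof. by case: z; case: w. Qed.

Lemma im_sub z w : im (z - w) = im z - im w.
Proof. by case: z; case: w. Qed.

Lemma cnormE z : `|z| = cmk (Num.sqrt (re z ^+ 2 + im z ^+ 2)) 0.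
Proof. by rewrite /cmk complexr0; exact: (@normc_def R z). Qed.

Lemma cmk_lt (s t : R) : (cmk s 0 < cmk t 0) = (s < t).
Proof. exact: ltcR. Qed.

Lemma cmk_le (s t : R) : (cmk s 0 <= cmk t 0) = (s <= t).
Proof. exact: lecR. Qed.

Lemma norm_re z : cmk `|re z| 0 <= `|z|.
Proof. by rewrite cnormE cmk_le -sqrtr_sqr ler_wsqrtr // lerDl sqr_ge0. Qed.

Lemma norm_im z : cmk `|im z| 0 <= `|z|.
Proof. by rewrite cnormE cmk_le -sqrtr_sqr ler_wsqrtr // lerDr sqr_ge0. Qed.

Lemma re_continuous : continuous re.
Proof.
move=> z; apply: (iffRL (@cvgrPdist_lt _ _ _ (nbhs z) _ re (re z))) => e e0.
have e0' : 0 < cmk e 0 by rewrite -[0]/(cmk 0 0) cmk_lt.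
have := nbhsx_ballx z _ e0'; apply: filterS => w; rewrite -ball_normE /= => h.
by rewrite -cmk_lt (le_lt_trans _ h) // -re_sub norm_re.
Qed.

Lemma im_continuous : continuous im.
Proof.
move=> z; apply: (iffRL (@cvgrPdist_lt _ _ _ (nbhs z) _ im (im z))) => e e0.
have e0' : 0 < cmk e 0 by rewrite -[0]/(cmk 0 0) cmk_lt.
have := nbhsx_ballx z _ e0'; apply: filterS => w; rewrite -ball_normE /= => h.
by rewrite -cmk_lt (le_lt_trans _ h) // -im_sub norm_im.
Qed.

(** Radii in [C] are complex numbers; the order only compares numbers with equal imaginary parts, so
    the positive ones are real. *)
Lemma gt0_cmk (e : C) : 0 < e -> exists2 r : R, 0 < r & e = cmk r 0.
Proof.
case: e => r s; rewrite ltcE /= => /andP[/eqP -> r0]; by exists r.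
Qed.

Lemma cmk_continuous : continuous (fun u : R * R => cmk u.1 u.2).
Proof.
move=> [s t]; apply/cvgrPdist_lt => _ /gt0_cmk[e e0 ->] /=.
have e2 : 0 < e / 2 by rewrite divr_gt0.
have h1 : \forall u \near (s, t), `|s - (u : R * R).1| < e / 2.
  apply: (iffLR (@cvgrPdist_lt _ _ _ (nbhs (s, t)) _ fst s)) => //.
  exact: cvg_fst.
have h2 : \forall u \near (s, t), `|t - (u : R * R).2| < e / 2.
  apply: (iffLR (@cvgrPdist_lt _ _ _ (nbhs (s, t)) _ snd t)) => //.
  exact: cvg_snd.
near=> u.
rewrite cnormE cmk_lt re_sub im_sub /=.
have u1 : `|s - u.1| < e / 2 by near: u; exact: h1.
have u2 : `|t - u.2| < e / 2 by near: u; exact: h2.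
rewrite -[ltRHS]gtr0_norm // -sqrtr_sqr ltr_sqrt ?exprn_gt0 //.
rewrite -(real_normK (num_real (s - u.1))) -(real_normK (num_real (t - u.2))).
have := normr_ge0 (s - u.1); have := normr_ge0 (t - u.2); nra.
Unshelve. all: end_near. Qed.

Lemma continuous_cmk (T : topologicalType) (f g : T -> R) (t : T) :
  {for t, continuous f} -> {for t, continuous g} ->
  {for t, continuous (fun u => cmk (f u) (g u))}.
Proof.
move=> cf cg.
apply: (@continuous_comp _ _ _ (fun u => (f u, g u)) (fun u => cmk u.1 u.2)).
  exact: cvg_to_pair.
exact: cmk_continuous.
Qed.

Definition segment_path x y (t : R) : C := x + cmk (clamp t) 0 * (y - x).

Lemma segment_path_continuous x y : continuous (segment_path x y).
Proof.
move=> t; apply: cvgD; first exact: cvg_cst.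
apply: cvgM; last exact: cvg_cst.
by apply: continuous_cmk; [exact: clamp_continuous|exact: cvg_cst].
Qed.

Lemma segment_path_ball x y e t : ball x e y -> ball x e (segment_path x y t).
Proof.
rewrite -ball_normE /= => h; apply: le_lt_trans h.
rewrite /segment_path opprD addrA subrr sub0r normrN normrM distrC.
apply: ler_piMl => //.
have /andP[c0 c1] := clamp_itv t.
rewrite ger0_norm; last by rewrite -[0]/(cmk 0 0) cmk_le.
by rewrite -[1]/(cmk 1 0) cmk_le.
Qed.

(* Paths are extended by constants to the whole line, so that continuity never
   has to be relativised to [0, 1]. *)
Definition path_from_to X p x y := [/\ continuous p, forall t, X (p t),
  forall t : R, t <= 0 -> p t = x & forall t : R, 1 <= t -> p t = y].

Lemma segment_path_from_to X x y : (forall t, X (segment_path x y t)) ->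
  path_from_to X (segment_path x y) x y.
Proof.
move=> h; split => // [|t t0|t t1]; first exact: segment_path_continuous.
  by rewrite /segment_path clamp_le0 // -[cmk 0 0]/(0 : C) mul0r addr0.
by rewrite /segment_path clamp_ge1 // -[cmk 1 0]/(1 : C) mul1r subrKC.
Qed.

(** Precomposing with a map into [A], in practice [clamp], turns continuity within [A] into
    continuity everywhere. *)
Lemma within_continuous_comp (S T U : topologicalType) (A : set T) (f : T -> U)
    (g : S -> T) :
  {within A, continuous f} -> continuous g -> (forall s, A (g s)) ->
  continuous (f \o g).
Proof.
move=> /subspace_continuousP cf cg gA s V hV.
have := cg s _ (cf (g s) (gA s) V hV).
by apply: (@filterS _ (nbhs s)) => r h; apply: h; exact: gA.
Qed.

Lemma path_in_from_to X p x y :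
  path_in X p x y -> path_from_to X (p \o clamp) x y.
Proof.
move=> [cp pX p0 p1]; split => [|t|t t0|t t1] /=.
- apply: (within_continuous_comp _ _ _ _ _ _ cp clamp_continuous).
  by move=> s; rewrite /= in_itv /=; exact: clamp_itv.
- by apply: pX; rewrite in_itv /=; exact: clamp_itv.
- by rewrite clamp_le0.
- by rewrite clamp_ge1.
Qed.

Definition path_rev p := fun t : R => p (1 - t).

(* As [p] and [q] are constant outside [0, 1], one of the two first terms is
   always [y]; continuity is then immediate. *)
Definition path_cat p q y := fun t : R => p (2 * t) + q (2 * t - 1) - y.

Lemma path_rev_from_to X p x y :
  path_from_to X p x y -> path_from_to X (path_rev p) y x.
Proof.
move=> [cp pX p0 p1]; split => [t|t|t t0|t t1]; rewrite /path_rev //.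
- apply: (@continuous_comp _ _ _ (fun t : R => 1 - t) p); last exact: cp.
  by apply: cvgB; [exact: cvg_cst|exact: cvg_id].
- by apply: p1; lra.
- by apply: p0; lra.
Qed.

Lemma path_cat_from_to X p q x y z :
  path_from_to X p x y -> path_from_to X q y z ->
  path_from_to X (path_cat p q y) x z.
Proof.
move=> [cp pX p0 p1] [cq qX q0 q1].
have c2 : continuous (fun t : R => 2 * t).
  by move=> t; apply: cvgM; [exact: cvg_cst|exact: cvg_id].
split => [t|t|t t0|t t1]; rewrite /path_cat.
- apply: cvgB; last exact: cvg_cst.
  apply: cvgD; first exact: (continuous_comp (c2 t) (cp _)).
  apply: (@continuous_comp _ _ _ (fun t : R => 2 * t - 1) q); last exact: cq.
  by apply: cvgB; [exact: c2|exact: cvg_cst].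
- have [t2|t2] := leP t (1 / 2).
    by rewrite q0; [rewrite addrK|lra].
  by rewrite p1; [rewrite addrC addKr|lra].
- by rewrite p0 ?q0; [rewrite addrK|lra|lra].
- by rewrite p1 ?q1; [rewrite addrC addKr|lra|lra].
Qed.

(** The total change of the angle of [(a, b)] along [p]. The angle itself is only determined up to a
    multiple of [2 * pi], but its change does not depend on the choice of [th]. *)
Definition angle_increment a b p (d : R) := exists th : R -> R,
  [/\ continuous th,
      forall t : R, 0 <= t <= 1 ->
        a (p t) = cos (th t) /\ b (p t) = sin (th t) &
      d = th 1 - th 0].

Lemma angle_increment_exists X a b p :
  (forall z, X z -> {for z, continuous a}) ->
  (forall z, X z -> {for z, continuous b}) ->
  (forall z, X z -> a z ^+ 2 + b z ^+ 2 = 1) ->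
  continuous p -> (forall t, X (p t)) -> exists d, angle_increment a b p d.
Proof.
move=> ca cb ab cp pX.
(* The path is lifted as a map of the square that ignores the second coordinate. *)
have [|||th cth thE] := square_lift (fun u => a (p u.1)) (fun u => b (p u.1)).
- move=> u; apply: (@continuous_comp _ _ _ fst (a \o p)); first exact: cvg_fst.
  exact: (continuous_comp (cp _) (ca _ (pX _))).
- move=> u; apply: (@continuous_comp _ _ _ fst (b \o p)); first exact: cvg_fst.
  exact: (continuous_comp (cp _) (cb _ (pX _))).
- by move=> u; exact: ab.
exists (th (1, 0) - th (0, 0)), (fun t => th (t, 0)); split => //.
- move=> t; apply: (@continuous_comp _ _ _ (fun t : R => (t, 0)) th).
    by apply: cvg_to_pair; [exact: cvg_id|exact: cvg_cst].
  exact: cth.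
- by move=> t ht; apply: thE; rewrite ?lexx ?ler01.
Qed.

(** Two lifts of the same values differ by a function of cosine 1, hence by a constant on [0, 1]. *)
Lemma angle_increment_unique a b p q d e : {in `[(0 : R), 1], p =1 q} ->
  angle_increment a b p d -> angle_increment a b q e -> d = e.
Proof.
move=> pq [th [cth thE ->]] [ph [cph phE ->]].
have I0 : `[(0 : R), 1]%classic 0 by rewrite /= in_itv /= lexx ler01.
have I1 : `[(0 : R), 1]%classic 1 by rewrite /= in_itv /= lexx ler01.
suff : th 1 - ph 1 = th 0 - ph 0 by lra.
apply: (@cos1_const _ _ `[(0 : R), 1] (fun t => th t - ph t)) => //.
  exact: segment_connected.
  by apply: continuous_subspaceT => t; apply: cvgB; [exact: cth|exact: cph].
move=> t; rewrite /= in_itv /= => ht.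
have [E1 E2] := thE t ht; have [E3 E4] := phE t ht.
have pqt : p t = q t by apply: pq; rewrite in_itv.
by apply: eq_angle_cos1; [rewrite -E1 -E3 pqt|rewrite -E2 -E4 pqt].
Qed.

Lemma angle_increment_cst a b x d : angle_increment a b (fun=> x) d -> d = 0.
Proof.
move=> [th [cth thE dE]]; have h : 0 <= (0 : R) <= 1 by rewrite lexx ler01.
apply: (@angle_increment_unique a b (fun=> x) (fun=> x)) => //.
  by exists th.
exists (fun=> th 0); split => [t|t _|]; [exact: cvg_cst|exact: thE|].
by rewrite subrr.
Qed.

Lemma angle_increment_rev a b p d :
  angle_increment a b p d -> angle_increment a b (path_rev p) (- d).
Proof.
move=> [th [cth thE ->]]; exists (fun t => th (1 - t)); split.
- move=> t; apply: (@continuous_comp _ _ _ (fun t : R => 1 - t) th);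
    last exact: cth.
  by apply: cvgB; [exact: cvg_cst|exact: cvg_id].
- by move=> t /andP[t0 t1]; apply: thE; apply/andP; split; lra.
- by rewrite subrr subr0 opprB.
Qed.

(** A lift along the concatenation, reparametrised on each half of [0, 1], is a lift along [p] and
    along [q]; uniqueness identifies the two increments. *)
Lemma angle_increment_cat X a b p q x y z d e f :
  path_from_to X p x y -> path_from_to X q y z ->
  angle_increment a b p d -> angle_increment a b q e ->
  angle_increment a b (path_cat p q y) f -> f = d + e.
Proof.
move=> [_ _ p0 p1] [_ _ q0 q1] hd he [th [cth thE ->]].
have dE : d = th (2^-1 * 1) - th (2^-1 * 0).
  apply: angle_increment_unique hd _; first by move=> t _.
  exists (fun t => th (2^-1 * t)); split => // [t|t /andP[t0 t1]].
    apply: (@continuous_comp _ _ _ (fun t : R => 2^-1 * t) th);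
    last exact: cth.
    by apply: cvgM; [exact: cvg_cst|exact: cvg_id].
  have := thE (2^-1 * t); rewrite /path_cat mulrA divff ?pnatr_eq0 // mul1r.
  by rewrite q0; [rewrite addrK; apply; apply/andP; split; lra|lra].
have eE : e = th (2^-1 * (1 + 1)) - th (2^-1 * (0 + 1)).
  apply: angle_increment_unique he _; first by move=> t _.
  exists (fun t => th (2^-1 * (t + 1))); split => // [t|t /andP[t0 t1]].
    apply: (@continuous_comp _ _ _ (fun t : R => 2^-1 * (t + 1)) th).
      apply: cvgM; first exact: cvg_cst.
      by apply: cvgD; [exact: cvg_id|exact: cvg_cst].
    exact: cth.
  have := thE (2^-1 * (t + 1)).
  rewrite /path_cat mulrA divff ?pnatr_eq0 // mul1r addrK.
  rewrite p1; last by lra.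
  by rewrite (addrC (y + _)) addKr; apply; apply/andP; split; lra.
have half : 2^-1 * (1 + 1) = 1 :> R by lra.
rewrite half add0r mulr1 in eE; rewrite mulr1 mulr0 in dE; lra.
Qed.

(** Null-homotopy of loops for paths extended by constants: [H] is continuous on all of [R * R],
    while its boundary values are prescribed on the unit square only. *)
Definition loops_contract X := forall p x, path_from_to X p x x ->
  exists H : R * R -> C, [/\ continuous H, forall u, X (H u),
    forall t : R, 0 <= t <= 1 -> H (0, t) = p t,
    forall t : R, 0 <= t <= 1 -> H (1, t) = x &
    forall s : R, 0 <= s <= 1 -> H (s, 0) = x /\ H (s, 1) = x].

Lemma simply_connected_loops X : simply_connected X -> loops_contract X.
Proof.
move=> [_ sc] p x [cp pX p0 p1].
have [|H [cH HX H0 H1 Hs]] := sc x p.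
  split => //; [exact: continuous_subspaceT|exact: p0|exact: p1].
have inI (s t : R) : s \in `[0, 1] -> t \in `[0, 1] -> X (H (s, t)).
  by move=> hs ht; apply: HX.
have cI t : clamp t \in `[(0 : R), 1] by rewrite in_itv /= clamp_itv.
exists (H \o (fun u => (clamp u.1, clamp u.2))); split.
- apply: (within_continuous_comp _ _ _ _ _ _ cH) => [|u]; last first.
    by split; exact: cI.
  move=> u; apply: cvg_to_pair.
    by apply: (@continuous_comp _ _ _ fst clamp);
      [exact: cvg_fst|exact: clamp_continuous].
  by apply: (@continuous_comp _ _ _ snd clamp);
    [exact: cvg_snd|exact: clamp_continuous].
- by move=> u /=; exact: inI.
- by move=> t ht /=; rewrite clamp0 clamp_id // H0 // in_itv.
- by move=> t ht /=; rewrite clamp1 H1 ?cI.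
- by move=> s hs /=; rewrite clamp0 clamp1; apply: Hs; exact: cI.
Qed.

(** Each point of the loop moves to [x] along a straight segment. *)
Lemma loops_contract_plane : loops_contract setT.
Proof.
move=> p x [cp _ p0 p1].
exists (fun u => segment_path (p u.2) x u.1); split => //.
- move=> u; have c2 : (fun u : R * R => p u.2) @ u --> p u.2.
    by apply: (@continuous_comp _ _ _ snd p); [exact: cvg_snd|exact: cp].
  apply: cvgD; first exact: c2.
  apply: cvgM; last by apply: cvgB; [exact: cvg_cst|exact: c2].
  apply: (@continuous_cmk _ (fun u : R * R => clamp u.1) (fun=> 0));
    last exact: cvg_cst.
  by apply: (@continuous_comp _ _ _ fst clamp);
    [exact: cvg_fst|exact: clamp_continuous].
- move=> t _.
  by have [_ _ -> //] := @segment_path_from_to setT (p t) x (fun=> I).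
- move=> t _.
  by have [_ _ _ -> //] := @segment_path_from_to setT (p t) x (fun=> I).
- by move=> s _ /=; rewrite p0 // p1 // /segment_path subrr mulr0 addr0.
Qed.

(** Lift [(a, b)] along the contracting homotopy. Three sides of the square are mapped to [x], so
    the angle is constant on them, and its change along the fourth side, which is [p], vanishes. *)
Lemma angle_increment_loop X a b p x d :
  (forall z, X z -> {for z, continuous a}) ->
  (forall z, X z -> {for z, continuous b}) ->
  (forall z, X z -> a z ^+ 2 + b z ^+ 2 = 1) ->
  loops_contract X -> path_from_to X p x x -> angle_increment a b p d -> d = 0.
Proof.
move=> ca cb ab cX hp hd; have [H [cH HX H0 H1 Hs]] := cX _ _ hp.
have [|||th cth thE] := square_lift (a \o H) (b \o H).
- by move=> u; exact: (continuous_comp (cH _) (ca _ (HX _))).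
- by move=> u; exact: (continuous_comp (cH _) (cb _ (HX _))).
- by move=> u; exact: ab.
have I0 : 0 <= (0 : R) <= 1 by rewrite lexx ler01.
have I1 : 0 <= (1 : R) <= 1 by rewrite lexx ler01.
have col (t : R) : continuous (fun s => th (s, t)).
  move=> s; apply: (@continuous_comp _ _ _ (fun s : R => (s, t)) th);
    last exact: cth.
  by apply: cvg_to_pair; [exact: cvg_id|exact: cvg_cst].
have row (s : R) : continuous (fun t => th (s, t)).
  move=> t; apply: (@continuous_comp _ _ _ (fun t : R => (s, t)) th);
    last exact: cth.
  by apply: cvg_to_pair; [exact: cvg_cst|exact: cvg_id].
have E0 : d = th (0, 1) - th (0, 0).
  apply: angle_increment_unique hd _; first by move=> t _.
  exists (fun t => th (0, t)); split => // t ht.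
  by rewrite -H0 //; exact: thE.
have E1 : th (1, 1) - th (1, 0) = 0.
  apply: (@angle_increment_cst a b x).
  exists (fun t => th (1, t)); split => // t ht.
  by rewrite -(H1 t) //; exact: thE.
have E2 : th (1, 0) - th (0, 0) = 0.
  apply: (@angle_increment_cst a b x).
  exists (fun s => th (s, 0)); split => // s hs.
  by rewrite -(Hs s hs).1; exact: thE.
have E3 : th (1, 1) - th (0, 1) = 0.
  apply: (@angle_increment_cst a b x).
  exists (fun s => th (s, 1)); split => // s hs.
  by rewrite -(Hs s hs).2; exact: thE.
lra.
Qed.

End PlaneLifts.

(** * Lifting over simply connected sets *)

Section SimplyConnectedLifts.
Context {R : realType}.
Local Notation C := (C R).
Implicit Types (X : set C) (p q : R -> C) (x y z w : C) (a b : C -> R).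

Definition angle_lift X a b (th : C -> R) :=
  (forall z, X z -> {for z, continuous th}) /\
  forall z, X z -> a z = cos (th z) /\ b z = sin (th z).

(** Relative to its value at [z], [(a, b)] stays in an open half circle over the ball, so the angle
    along the segment is given by one arcsine. *)
Lemma angle_increment_segment a b e z w : ball z e w ->
  (forall u, ball z e u -> {for u, continuous a}) ->
  (forall u, ball z e u -> {for u, continuous b}) ->
  (forall u, ball z e u -> a u ^+ 2 + b u ^+ 2 = 1) ->
  (forall u, ball z e u -> 0 < a z * a u + b z * b u) ->
  angle_increment a b (segment_path z w) (asin (a z * b w - b z * a w)).
Proof.
move=> zw ca cb ab dot.
have sX t := @segment_path_ball _ _ _ _ t zw.
have [_ _ s0 s1] := @segment_path_from_to R _ _ _ sX.
have zz := sX 0; rewrite s0 // in zz.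
have [t [at_ bt]] := unit_circle_angle _ _ (ab z zz).
pose q u := cos t * b u - sin t * a u.
have cq u : ball z e u -> {for u, continuous q}.
  move=> hu; apply: continuous_at_sub; apply: continuous_at_mul;
    by [exact: continuous_at_cst|exact: ca|exact: cb].
exists (fun s => t + asin (q (segment_path z w s))); split.
- move=> s; apply: cvgD; first exact: cvg_cst.
  apply: (@continuous_comp _ _ _ (fun s : R => q (segment_path z w s)) asin).
    exact: (continuous_comp (@segment_path_continuous R z w s) (cq _ (sX s))).
  apply: continuous_asin; set u := segment_path z w s.
  have := dot u (sX s); have := ab u (sX s); have := cos2Dsin2 t.
  rewrite at_ bt /q => cs ab1.
  set d := cos t * a u + sin t * b u => d0.
  have : d ^+ 2 + q u ^+ 2 = (cos t ^+ 2 + sin t ^+ 2) * (a u ^+ 2 + b u ^+ 2).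
    by rewrite /q /d; ring.
  rewrite cs ab1 mulr1 -/(q u) => pq.
  have p2 : 0 < d ^+ 2 by rewrite exprn_gt0.
  by apply/andP; split; nra.
- move=> s _; apply: angle_step; first exact: ab.
  by rewrite -at_ -bt; exact: dot.
- rewrite s1 // s0 // /q -at_ -bt.
  have -> : a z * b z - b z * a z = 0 by ring.
  have -> : asin (0 : R) = 0.
    rewrite -{1}sin0 sinK // in_itv /=.
    by have := @pi_gt0 R => p0; apply/andP; split; lra.
  ring.
Qed.

(** Monodromy: the angle at [z] is the angle at a base point plus the increment along a chosen path
    to [z]. Loops have increment 0, so near [z] this function is given by an arcsine formula, which
    makes it continuous. *)
Lemma angle_lift_exists X a b : open X ->
  (forall x y, X x -> X y -> exists p, path_from_to X p x y) ->
  loops_contract X ->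
  (forall z, X z -> {for z, continuous a}) ->
  (forall z, X z -> {for z, continuous b}) ->
  (forall z, X z -> a z ^+ 2 + b z ^+ 2 = 1) ->
  exists th, angle_lift X a b th.
Proof.
move=> oX pcX lX ca cb ab.
have [[x0 Xx0]|X0] := pselect (X !=set0); last first.
  by exists (fun=> 0); split => z Xz; exfalso; apply: X0; exists z.
have [t0 [at0 bt0]] := unit_circle_angle _ _ (ab x0 Xx0).
have /choice[D HD] : forall z, exists d : R, X z ->
    exists2 p, path_from_to X p x0 z & angle_increment a b p d.
  move=> z; have [Xz|Xz] := pselect (X z); last by exists 0.
  have [p hp] := pcX _ _ Xx0 Xz; have [cp pX _ _] := hp.
  have [d hd] := @angle_increment_exists R X a b p ca cb ab cp pX.
  by exists d => _; exists p.
have lift z : X z -> a z = cos (t0 + D z) /\ b z = sin (t0 + D z).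
  move=> Xz; have [p [_ _ p0 p1] [th [_ thE dE]]] := HD z Xz.
  have [] := thE 0; first by rewrite lexx ler01.
  have [] := thE 1; first by rewrite lexx ler01.
  rewrite (p0 0) // (p1 1) // at0 bt0 => -> -> c0 s0.
  have -> : th 1 = th 0 + D z by rewrite dE; ring.
  by rewrite !cosD !sinD c0 s0.
exists (fun z => t0 + D z); split => // z Xz.
apply: continuous_at_add; first exact: continuous_at_cst.
have near_dot : nbhs z (X `&` [set w | 0 < a z * a w + b z * b w]).
  apply: filterI; first exact: open_nbhs_nbhs.
  have : {for z, continuous (fun w => a z * a w + b z * b w)}.
    by apply: continuous_at_add; apply: continuous_at_mul;
      [exact: continuous_at_cst|exact: ca|exact: continuous_at_cst|exact: cb].
  move=> H; apply: (H [set r | 0 < r]); apply: lt_nbhsr.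
  by rewrite -!expr2 ab // ltr01.
have /nbhs_ballP[e /= e0 hB] := near_dot.
have step w : ball z e w -> D w = D z + asin (a z * b w - b z * a w).
  move=> zw; have [Xw _] := hB w zw.
  have BX u : ball z e u -> X u by move=> /hB[].
  have seg : path_from_to X (segment_path z w) z w.
    by apply: segment_path_from_to => t; apply: BX; exact: segment_path_ball.
  have segi : angle_increment a b (segment_path z w)
      (asin (a z * b w - b z * a w)).
    apply: (@angle_increment_segment a b e) => // u hu.
    - by apply: ca; exact: BX.
    - by apply: cb; exact: BX.
    - by apply: ab; exact: BX.
    - by have [] := hB u hu.
  (* The loop goes from [x0] to [z] by the chosen path, to [w] by the segment, and back along the
     path chosen for [w]; its increment is 0. *)
  have [pz hpz hDz] := HD z Xz; have [pw hpw hDw] := HD w Xw.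
  have hzw := path_cat_from_to _ _ _ _ _ _ hpz seg.
  have [czw zwX _ _] := hzw.
  have [f hf] := @angle_increment_exists R X a b _ ca cb ab czw zwX.
  have hr := path_rev_from_to _ _ _ _ hpw.
  have hl := path_cat_from_to _ _ _ _ _ _ hzw hr.
  have [cl lX' _ _] := hl.
  have [g hg] := @angle_increment_exists R X a b _ ca cb ab cl lX'.
  have g0 := angle_increment_loop _ _ _ _ _ _ ca cb ab lX hl hg.
  have fE := angle_increment_cat _ _ _ _ _ _ _ _ _ _ _ hpz seg hDz segi hf.
  have gE := angle_increment_cat _ _ _ _ _ _ _ _ _ _ _ hzw hr hf
    (angle_increment_rev _ _ _ _ hDw) hg.
  lra.
have asc : {for z, continuous (fun w => D z + asin (a z * b w - b z * a w))}.
  apply: continuous_at_add; first exact: continuous_at_cst.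
  apply: (@continuous_comp _ _ _ (fun w => a z * b w - b z * a w) asin).
    by apply: continuous_at_sub; apply: continuous_at_mul;
      [exact: continuous_at_cst|exact: cb|exact: continuous_at_cst|exact: ca].
  apply: continuous_asin.
  have -> : a z * b z - b z * a z = 0 by ring.
  by apply/andP; split; lra.
move=> V; rewrite {1}(step z (ballxx _ e0)) => /asc hV.
apply: (@filterS2 _ (nbhs z) _ _ _ _ _ hV (nbhsx_ballx z _ e0)) => w /=.
by move=> hw /step ->.
Qed.

Lemma plane_angle_lift a b : continuous a -> continuous b ->
  (forall z, a z ^+ 2 + b z ^+ 2 = 1) ->
  exists2 th : C -> R, continuous th &
    forall z, a z = cos (th z) /\ b z = sin (th z).
Proof.
move=> ca cb ab.
have [||||||th [cth thE]] := @angle_lift_exists setT a b.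
- exact: openT.
- by move=> x y _ _; exists (segment_path x y); exact: segment_path_from_to.
- exact: loops_contract_plane.
- by move=> z _; exact: ca.
- by move=> z _; exact: cb.
- by move=> z _; exact: ab.
by exists th => z; [exact: cth|exact: thE].
Qed.

End SimplyConnectedLifts.

(** * The winding argument *)

Section Winding.
Context {R : realType}.
Local Notation C := (C R).
Implicit Types (V : set C) (x y z w : C).

Lemma near_eq_continuous (T U : topologicalType) (f g : T -> U) (t : T) :
  (\forall u \near t, f u = g u) -> {for t, continuous f} ->
  {for t, continuous g}.
Proof.
move=> fg cf W; rewrite /= -(nbhs_singleton fg) => /cf hW.
by apply: (@filterS2 _ (nbhs t) _ _ _ _ _ hW fg) => u /= + <-.
Qed.

(** The Euclidean distance with values in [R], whereas the norm of [C] is complex-valued. *)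
Definition cdist z w : R := Num.sqrt (re (z - w) ^+ 2 + im (z - w) ^+ 2).

Lemma cdist_gt0 z w : z != w -> 0 < cdist z w.
Proof.
move=> zw; rewrite sqrtr_gt0 lt_neqAle addr_ge0 ?sqr_ge0 // andbT eq_sym.
rewrite paddr_eq0 ?sqr_ge0 // !sqrf_eq0.
apply: contraNN zw => /andP[/eqP h1 /eqP h2].
by rewrite -subr_eq0 -(cmkK (z - w)) h1 h2.
Qed.

Lemma re_sub_continuous w : continuous (fun z => re (z - w)).
Proof.
have -> : (fun z => re (z - w)) = (fun z => re z - re w).
  by apply/funext => z; rewrite re_sub.
by move=> z; apply: continuous_at_sub;
  [exact: re_continuous|exact: continuous_at_cst].
Qed.

Lemma im_sub_continuous w : continuous (fun z => im (z - w)).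
Proof.
have -> : (fun z => im (z - w)) = (fun z => im z - im w).
  by apply/funext => z; rewrite im_sub.
by move=> z; apply: continuous_at_sub;
  [exact: im_continuous|exact: continuous_at_cst].
Qed.

Lemma cdist_continuous w : continuous (cdist ^~ w).
Proof.
move=> z.
apply: (@continuous_comp _ _ _ (fun z => re (z - w) ^+ 2 + im (z - w) ^+ 2)
  Num.sqrt); last exact: sqrt_continuous.
by apply: continuous_at_add; apply: continuous_at_mul;
  [exact: re_sub_continuous|exact: re_sub_continuous|
   exact: im_sub_continuous|exact: im_sub_continuous].
Qed.

Lemma cdistV_continuous w z : z != w ->
  {for z, continuous (fun z => (cdist z w)^-1)}.
Proof.
move=> zw; apply: (@continuous_comp _ _ _ (cdist ^~ w) GRing.inv).
  exact: cdist_continuous.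
by apply: inv_continuous; rewrite gt_eqF // cdist_gt0.
Qed.

Definition circle_path w (r t : R) : C := w + cmk (r * cos t) (r * sin t).

Lemma circle_path_continuous w r : continuous (circle_path w r).
Proof.
move=> t; apply: cvgD; first exact: cvg_cst.
apply: (@continuous_cmk _ _ (fun t => r * cos t) (fun t => r * sin t));
  apply: cvgM; [exact: cvg_cst|exact: continuous_cos|
    exact: cvg_cst|exact: continuous_sin].
Qed.

(* The factor [clamp (phi z - phi p - 1 / 2)] fades the angle [psi] out where
   [phi z] is near [phi p], and leaves it unchanged where [phi z] is at least
   [phi p + 3 / 2], in particular near the other values of [phi] off [V]. *)
Lemma glue_continuous V (phi psi n : C -> R) (c : R -> R) (p : C) :
  open V -> continuous phi -> ~ V p ->
  (forall z, ~ V z -> cos (phi z - phi p) = 1) ->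
  (forall z, V z -> {for z, continuous psi}) ->
  (forall z, V z -> n z = c (psi z)) ->
  (forall z, z != p -> {for z, continuous n}) ->
  continuous c ->
  continuous (fun z =>
    if `[< V z >] then c (clamp (phi z - phi p - 1 / 2) * psi z)
    else if phi z < phi p + 1 then c 0 else n z).
Proof.
move=> oV cphi Vp off cpsi nE cn cc z.
have cchi : {for z, continuous (fun z => clamp (phi z - phi p - 1 / 2))}.
  apply: (@continuous_comp _ _ _ (fun z => phi z - phi p - 1 / 2) clamp).
    apply: continuous_at_sub; last exact: continuous_at_cst.
    by apply: continuous_at_sub; [exact: cphi|exact: continuous_at_cst].
  exact: clamp_continuous.
have [Vz|nVz] := pselect (V z).
  apply: (@near_eq_continuous _ _
    (fun z => c (clamp (phi z - phi p - 1 / 2) * psi z))).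
    have : nbhs z V by exact: open_nbhs_nbhs.
    by apply: filterS => w Vw; rewrite asboolT.
  apply: (@continuous_comp _ _ _
    (fun z => clamp (phi z - phi p - 1 / 2) * psi z) c); last exact: cc.
  by apply: continuous_at_mul; [exact: cchi|exact: cpsi].
(* Off [V], [phi z - phi p] is either at most 0 or greater than 3/2; near [z] the glued map is [c 0]
   in the first case and [n] in the second. *)
have [d0|d0] := leP (phi z - phi p) 0.
  apply: (@near_eq_continuous _ _ (fun=> c 0)); last exact: continuous_at_cst.
  have : nbhs z [set w | phi w < phi p + 1 / 2].
    by apply: (cphi z [set s | s < phi p + 1 / 2]); apply: lt_nbhsl; lra.
  apply: filterS => w /= hw; have [Vw|nVw] := pselect (V w).
    rewrite asboolT // clamp_le0 ?mul0r //; lra.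
  by rewrite asboolF // ifT //; lra.
have d1 := cos1_gt1 _ (off z nVz) d0.
apply: (@near_eq_continuous _ _ n).
  have : nbhs z [set w | phi p + 3 / 2 < phi w].
    by apply: (cphi z [set s | phi p + 3 / 2 < s]); apply: lt_nbhsr; lra.
  apply: filterS => w /= hw; have [Vw|nVw] := pselect (V w).
    rewrite asboolT // clamp_ge1 ?mul1r ?nE //; lra.
  by rewrite asboolF // ifF //; apply/negbTE; rewrite -leNgt; lra.
by apply: cn; apply: contraTneq d0 => ->; rewrite subrr ltxx.
Qed.

(* Otherwise glueing with [n z := (z - p) / |z - p|] gives a circle-valued map of
   the plane which is [n] on the circle: it lifts, but [n] winds around [p]. *)
Lemma angle_le_outside V (phi : C -> R) (p : C) (r : R) : open V ->
  (forall x y, V x -> V y -> exists q, path_from_to V q x y) ->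
  loops_contract V -> continuous phi -> ~ V p ->
  (forall z, ~ V z -> cos (phi z - phi p) = 1) ->
  0 < r -> (forall t, ~ V (circle_path p r t)) ->
  phi (circle_path p r 0) <= phi p.
Proof.
move=> oV pcV lV cphi Vp off r0 circV; rewrite leNgt; apply/negP => gt0.
have neqp z : V z -> z != p by move=> Vz; apply: contra_notN Vp => /eqP <-.
pose na z := re (z - p) * (cdist z p)^-1.
pose nb z := im (z - p) * (cdist z p)^-1.
have cna z : z != p -> {for z, continuous na}.
  move=> zp; apply: continuous_at_mul; first exact: re_sub_continuous.
  exact: cdistV_continuous.
have cnb z : z != p -> {for z, continuous nb}.
  move=> zp; apply: continuous_at_mul; first exact: im_sub_continuous.
  exact: cdistV_continuous.
have nab z : z != p -> na z ^+ 2 + nb z ^+ 2 = 1.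
  move=> zp; rewrite /na /nb !exprMn -mulrDl.
  have -> : re (z - p) ^+ 2 + im (z - p) ^+ 2 = cdist z p ^+ 2.
    by rewrite sqr_sqrtr // addr_ge0 ?sqr_ge0.
  by rewrite -exprMn divff ?expr1n // gt_eqF // cdist_gt0.
have [psi [cpsi psiE]] := @angle_lift_exists R V na nb oV pcV lV
  (fun z Vz => cna z (neqp z Vz)) (fun z Vz => cnb z (neqp z Vz))
  (fun z Vz => nab z (neqp z Vz)).
have cFa := @glue_continuous V phi psi na cos p oV cphi Vp off cpsi
  (fun z Vz => (psiE z Vz).1) cna (@continuous_cos R).
have cFb := @glue_continuous V phi psi nb sin p oV cphi Vp off cpsi
  (fun z Vz => (psiE z Vz).2) cnb (@continuous_sin R).
have [|th cth thE] := plane_angle_lift _ _ cFa cFb.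
  move=> z; case: asboolP => Vz; first exact: cos2Dsin2.
  case: ifPn => h; first exact: cos2Dsin2.
  (* Here [phi z >= phi p + 1], which excludes [z = p], the singularity of the direction field. *)
  by apply: nab; apply: contraNneq h => ->; rewrite ltrDl ltr01.
pose s := circle_path p r.
have pi0 := @pi_gt0 R.
pose I : set R := [set` `[(0 : R), 2 * pi]].
have I0 : I 0 by rewrite /I /= in_itv /= lexx; lra.
have cI : connected I by exact: segment_connected.
have phis t : I t -> phi (s t) = phi (s 0).
  move=> It; suff : phi (s t) - phi p = phi (s 0) - phi p by lra.
  apply: (@cos1_const _ _ I (fun t => phi (s t) - phi p)) => //.
    apply: continuous_subspaceT => u.
    apply: continuous_at_sub; last exact: continuous_at_cst.
    exact: (continuous_comp (@circle_path_continuous p r u) (cphi _)).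
  by move=> u _; apply: off; exact: circV.
have gt1 : 3 / 2 < phi (s 0) - phi p.
  apply: cos1_gt1; last by rewrite subr_gt0.
  by apply: off; exact: circV.
have sp t : s t - p = cmk (r * cos t) (r * sin t).
  by rewrite /s /circle_path addrC addKr.
have ds t : cdist (s t) p = r.
  rewrite /cdist sp /= !exprMn -mulrDr cos2Dsin2 mulr1 sqrtr_sqr.
  by rewrite gtr0_norm.
have nas t : na (s t) = cos t.
  by rewrite /na ds sp /= mulrAC divff ?mul1r // gt_eqF.
have nbs t : nb (s t) = sin t.
  by rewrite /nb ds sp /= mulrAC divff ?mul1r // gt_eqF.
have lifts t : I t -> cos t = cos (th (s t)) /\ sin t = sin (th (s t)).
  move=> It; have := thE (s t); rewrite asboolF; last exact: circV.
  rewrite nas nbs; case: ifPn => // h.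
  by rewrite phis // in h; lra.
(* On the circle both [th (s t)] and [t] are angles of the same point, so they differ by a constant;
   but [s] closes up after [2 * pi]. *)
have : th (s 0) - 0 = th (s (2 * pi)) - 2 * pi.
  apply: (@cos1_const _ _ I (fun t => th (s t) - t)) => //.
  - apply: continuous_subspaceT => u; apply: continuous_at_sub.
      exact: (continuous_comp (@circle_path_continuous p r u) (cth _)).
    exact: cvg_id.
  - by move=> t It; have [h1 h2] := lifts t It; apply: eq_angle_cos1.
  - by rewrite /I /= in_itv /= lexx andbT; lra.
have -> : s (2 * pi) = s 0.
  have -> : 2 * pi = 0 + pi *+ 2 :> R by rewrite add0r mulr_natl.
  by rewrite /s /circle_path cosD2pi sinD2pi.
lra.
Qed.

End Winding.

(** * Boundaries of bounded simply connected domains *)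

Section BoundaryConnected.
Context {R : realType}.
Local Notation C := (C R).
Implicit Types (U V A B : set C) (x y z w : C).

Lemma bounded_re_im V : bounded_set V ->
  exists2 M : R, 0 <= M & forall z, V z -> `|re z| <= M /\ `|im z| <= M.
Proof.
move=> [M0 [/complex_realP[m ->] H]].
have lem : m < `|m| + 1 by rewrite (le_lt_trans (ler_norm m)) // ltrDl ltr01.
exists (`|m| + 1); first by rewrite addr_ge0.
move=> z Vz; have := H (cmk (`|m| + 1) 0).
rewrite -complexr0 cmk_lt => /(_ lem z Vz) /= h.
by split; rewrite -cmk_le; [exact: le_trans (norm_re z) h|
  exact: le_trans (norm_im z) h].
Qed.

Lemma re_segment_path x y t :
  re (segment_path x y t) = re x + clamp t * (re y - re x).
Proof.
rewrite /segment_path re_add -re_sub; case: (y - x) => c d /=.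
by rewrite mul0r subr0.
Qed.

(** In [V] the coordinates relative to [p] would be at most [M + |re p|] and [M + |im p|] in
    absolute value, and [r] is at most the sum of these absolute values. *)
Lemma circle_path_outside V (M r : R) p t :
  (forall z, V z -> `|re z| <= M /\ `|im z| <= M) -> 0 <= M ->
  2 * M + `|re p| + `|im p| < r -> ~ V (circle_path p r t).
Proof.
move=> hM M0 hr /hM[]; rewrite /circle_path re_add im_add /= => h1 h2.
have rp := normr_ge0 (re p); have ip := normr_ge0 (im p).
have k1 : `|r * cos t| <= M + `|re p|.
  have := ler_normB (re p + r * cos t) (re p); rewrite addrC addKr; lra.
have k2 : `|r * sin t| <= M + `|im p|.
  have := ler_normB (im p + r * sin t) (im p); rewrite addrC addKr; lra.
have : r ^+ 2 = `|r * cos t| ^+ 2 + `|r * sin t| ^+ 2.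
  by rewrite !real_normK ?num_real // !exprMn -mulrDr cos2Dsin2 mulr1.
have := normr_ge0 (r * cos t); have := normr_ge0 (r * sin t).
set u := `|r * cos t| in k1 *; set v := `|r * sin t| in k2 *.
move: k1 k2 hr rp ip; set a := `|re p|; set b := `|im p| => *; nra.
Qed.

(** [angle_le_outside] for [phi] and for [- phi] equates [phi p] with the value at the rightmost
    point of a large circle around [p], and likewise for [q]. The two rightmost points are then
    joined off [V]. *)
Lemma angle_const_outside V (phi : C -> R) p q : open V ->
  (forall x y, V x -> V y -> exists q, path_from_to V q x y) ->
  loops_contract V -> bounded_set V -> continuous phi ->
  (forall z, ~ V z -> cos (phi z) = 1) -> ~ V p -> ~ V q -> phi p = phi q.
Proof.
move=> oV pcV lV /bounded_re_im[M M0 hM] cphi off Vp Vq.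
have offB x z : ~ V x -> ~ V z -> cos (phi x - phi z) = 1.
  move=> Vx Vz; rewrite cosB !off // (cos1_sin0 _ (off x Vx)); ring.
have rp := normr_ge0 (re p); have ip := normr_ge0 (im p).
have rq := normr_ge0 (re q); have iq := normr_ge0 (im q).
have bnd (a : R) : exists b : R, [/\ 0 <= b, - b <= a & a <= b].
  by exists `|a|; rewrite normr_ge0 ler_norm lerNnormlW.
have [P [P0 lp _]] := bnd (re p); have [Q [Q0 lq _]] := bnd (re q).
have [r [r0 rpq hrp hrq]] : exists r : R, [/\ 0 < r, M + P + Q < r,
    2 * M + `|re p| + `|im p| < r & 2 * M + `|re q| + `|im q| < r].
  exists (2 * M + `|re p| + `|im p| + `|re q| + `|im q| + P + Q + 1).
  by split; lra.
have circ x : x = p \/ x = q -> forall t, ~ V (circle_path x r t).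
  by move=> [->|->] t; apply: (circle_path_outside _ M).
have out x : x = p \/ x = q -> phi x = phi (circle_path x r 0).
  move=> xpq; have Vx : ~ V x by case: xpq => ->.
  apply/eqP; rewrite eq_le -[X in X && _]lerN2; apply/andP; split; last first.
    apply: (@angle_le_outside R V) => //; last exact: circ.
    by move=> z Vz; exact: offB.
  apply: (@angle_le_outside R V (fun z => - phi z)) => //; last exact: circ.
    by move=> z; apply: (continuous_comp (cphi z)); exact: oppr_continuous.
  by move=> z Vz; rewrite opprK addrC; exact: offB.
rewrite (out p) ?(out q); [|by right|by left].
pose s := segment_path (circle_path p r 0) (circle_path q r 0).
have [cs _ s0 s1] := @segment_path_from_to R setT
  (circle_path p r 0) (circle_path q r 0) (fun=> I).
have <- : s 0 = circle_path p r 0 by exact: s0.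
have <- : s 1 = circle_path q r 0 by exact: s1.
(* The whole segment has real part at least [r - P - Q > M], so it passes to the right of [V]. *)
have Vs t : ~ V (s t).
  move=> /hM[+ _]; rewrite re_segment_path /circle_path !re_add /= cos0 mulr1.
  have /andP[c0 c1] := clamp_itv t; move: c0 c1; set c := clamp t => c0 c1.
  move=> /(le_trans (ler_norm _)) => le.
  have [e eE] : exists e : R, e = c * (re q - re p) by eexists.
  have le' : re p + e + r <= M.
    move: le; apply: le_trans; rewrite eE le_eqVlt.
    by apply/orP; left; apply/eqP; ring.
  have c1' : 0 <= 1 - c by rewrite subr_ge0.
  have hp : 0 <= re p + P by lra.
  have hq : 0 <= re q + Q by lra.
  have := mulr_ge0 c0 hq; have := mulr_ge0 c0 P0.
  have := mulr_ge0 c1' hp; have := mulr_ge0 c1' Q0 => h1 h2 h3 h4.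
  have h : - P - Q <= re p + e by rewrite eE; lra.
  lra.
suff : phi (s 0) - phi (s 0) = phi (s 1) - phi (s 0) by lra.
apply: (@cos1_const _ _ `[(0 : R), 1] (fun t => phi (s t) - phi (s 0))) => //.
- exact: segment_connected.
- apply: continuous_subspaceT => t; apply: continuous_at_sub.
    exact: (continuous_comp (cs t) (cphi _)).
  exact: continuous_at_cst.
- by move=> t _; exact: offB.
- by rewrite /= in_itv /= lexx ler01.
- by rewrite /= in_itv /= lexx ler01.
Qed.

(** The two pieces agree on the boundary of [V], and a point outside the closure has a neighbourhood
    where the map is constant. *)
Lemma cut_continuous V (g : C -> R) (k : R) : open V -> continuous g ->
  (forall z, closure V z -> ~ V z -> g z = k) ->
  continuous (fun z => if `[< V z >] then g z else k).
Proof.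
move=> oV cg gk z; have [Vz|nVz] := pselect (V z).
  apply: (@near_eq_continuous _ _ g); last exact: cg.
  have : nbhs z V by exact: open_nbhs_nbhs.
  by apply: filterS => w Vw; rewrite asboolT.
have [cz|ncz] := pselect (closure V z).
  move=> W; rewrite /= asboolF // => hW.
  have := cg z W; rewrite gk // => /(_ hW).
  apply: (@filterS _ (nbhs z)) => w /= hw; case: asboolP => // _.
  exact: nbhs_singleton.
apply: (@near_eq_continuous _ _ (fun=> k)); last exact: continuous_at_cst.
have : nbhs z (~` closure V).
  apply: open_nbhs_nbhs; split => //; apply: closed_openC.
  exact: closed_closure.
apply: filterS => w /= hw; rewrite asboolF // => Vw; apply: hw.
exact: subset_closure.
Qed.

(** Urysohn's lemma is applied in [R * R], whose balls have real radii, and carried over to [C] by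
    the coordinates. *)
Lemma plane_urysohn A B (k : R) : closed A -> closed B -> A `&` B = set0 ->
  0 < k -> exists u : C -> R,
    [/\ continuous u, forall z, A z -> u z = 0 & forall z, B z -> u z = k].
Proof.
move=> cA cB AB k0; pose m (u : R * R) : C := cmk u.1 u.2.
have cm : continuous m by exact: cmk_continuous.
have [|||u [cu uA uB _]] := @urysohn_ext_itv _ R
  (@pseudometric_normal R (R * R)%type) (m @^-1` A) (m @^-1` B) 0 k _ _ _ k0.
- by apply: preimage_closed => // w _; exact: cm.
- by apply: preimage_closed => // w _; exact: cm.
- by rewrite -preimage_setI AB preimage_set0.
exists (fun z => u (re z, im z)); split.
- move=> z; apply: (@continuous_comp _ _ _ (fun z => (re z, im z)) u).
    by apply: continuous_at_pair; [exact: re_continuous|exact: im_continuous].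
  exact: cu.
- by move=> z Az; apply: uA; exists (re z, im z) => //; rewrite /m /= cmkK.
- by move=> z Bz; apply: uB; exists (re z, im z) => //; rewrite /m /= cmkK.
Qed.

(* The circle-valued map equal to [exp (i u)] on [V] and [1] elsewhere lifts to an
   angle [phi]; then [phi - u] is constant on the closure of [V], while [phi] is
   constant off [V]. *)
Lemma closure_boundary_connected V A B p q : open V -> connected V ->
  (forall x y, V x -> V y -> exists q, path_from_to V q x y) ->
  loops_contract V -> bounded_set V -> closed A -> closed B ->
  A `&` B = set0 -> (forall z, closure V z -> [\/ V z, A z | B z]) ->
  closure V p -> ~ V p -> A p -> closure V q -> ~ V q -> B q -> False.
Proof.
move=> oV conV pcV lV bV cA cB AB clV clp Vp Ap clq Vq Bq.
have pi0 := @pi_gt0 R.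
have [u [cu uA uB]] := plane_urysohn _ _ _ cA cB AB (mulr_gt0 (ltr0Sn R 1) pi0).
have c2pi : cos (2 * pi) = 1 :> R.
  by rewrite mulr_natl -[pi *+ 2]add0r cosD2pi cos0.
have cosu z : closure V z -> ~ V z -> cos (u z) = 1.
  by move=> /clV[//|/uA ->|/uB ->] _; rewrite ?cos0.
have ca : continuous (fun z => cos (u z)).
  by move=> z; exact: (continuous_comp (cu z) (@continuous_cos R _)).
have cb : continuous (fun z => sin (u z)).
  by move=> z; exact: (continuous_comp (cu z) (@continuous_sin R _)).
have cFa := cut_continuous _ _ 1 oV ca cosu.
have cFb := cut_continuous _ _ 0 oV cb
  (fun z h1 h2 => cos1_sin0 _ (cosu z h1 h2)).
have [|phi cphi phiE] := plane_angle_lift _ _ cFa cFb.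
  move=> z; case: asboolP => _; first exact: cos2Dsin2.
  by rewrite expr1n expr0n addr0.
have off z : ~ V z -> cos (phi z) = 1.
  by move=> Vz; have [] := phiE z; rewrite asboolF.
have pq : phi p = phi q by exact: angle_const_outside off Vp Vq.
have : phi p - u p = phi q - u q.
  apply: (@cos1_const _ _ (closure V) (fun z => phi z - u z)) => //.
  - exact: connected_closure.
  - apply: continuous_subspaceT => z.
    by apply: continuous_at_sub; [exact: cphi|exact: cu].
  (* On [V], [phi] and [u] are angles of the same point; on its boundary both have cosine 1. *)
  - move=> z cz; have [Vz|Vz] := pselect (V z).
      have [] := phiE z; rewrite asboolT // => h1 h2.
      exact: eq_angle_cos1.
    rewrite cosB off // cosu // (cos1_sin0 _ (off z Vz)); ring.
rewrite uA // uB // pq; lra.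
Qed.

End BoundaryConnected.

(** * Components *)

Section Components.
Context {R : realType}.
Local Notation C := (C R).
Implicit Types (U V A B : set C) (x y z w : C).

Lemma segment_path_connected x y (I : set R) : connected I ->
  connected (segment_path x y @` I).
Proof.
move=> cI; apply: connected_continuous_connected => //.
by apply: continuous_subspaceT; exact: segment_path_continuous.
Qed.

Lemma component_ball U x z e : connected_component U x z -> 0 < e ->
  ball z e `<=` U -> ball z e `<=` connected_component U x.
Proof.
move=> xz e0 zU w zw; apply: connected_component_trans xz _.
have [_ _ s0 s1] := @segment_path_from_to R setT z w (fun=> I).
have cS := @segment_path_connected z w `[0, 1] (@segment_connected _ _ _).
apply: connected_component_max cS _ _.
- by exists 0; [rewrite /= in_itv /= lexx ler01|exact: s0].
- by move=> _ [t _ <-]; apply: zU; exact: segment_path_ball.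
- by exists 1; [rewrite /= in_itv /= lexx ler01|exact: s1].
Qed.

Lemma component_open U x : open U -> open (connected_component U x).
Proof.
move=> oU; rewrite openE => z xz.
have /nbhs_ballP[e /= e0 zU] : nbhs z U.
  by apply: open_nbhs_nbhs; split => //; exact: connected_component_sub xz.
apply: (@filterS _ (nbhs z) _ _ _ _ (nbhsx_ballx z _ e0)).
exact: component_ball.
Qed.

(** The component of [z] is an open neighbourhood of [z], so it meets the component of [x], and the
    two coincide. *)
Lemma closure_component U x z : open U -> closure (connected_component U x) z ->
  U z -> connected_component U x z.
Proof.
move=> oU clz Uz.
have [|w [xw zw]] := clz (connected_component U z).
  apply: open_nbhs_nbhs; split; first exact: component_open.
  exact: connected_component_refl.
by apply: connected_component_trans xw _; exact: connected_component_sym.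
Qed.

Lemma path_from_to_component U x : path_connected (connected_component U x) ->
  forall y z, connected_component U x y -> connected_component U x z ->
  exists p, path_from_to (connected_component U x) p y z.
Proof.
move=> [_ pc] y z xy xz; have [p hp] := pc y z xy xz.
by exists (p \o clamp); exact: path_in_from_to.
Qed.

(* On a segment from A to B take the last parameter in A and then the first
   later one in B; the open interval in between lies in one component. *)
Lemma component_between U A B : open U -> closed A -> closed B ->
  A !=set0 -> B !=set0 -> A `&` B = set0 -> ~` U = A `|` B ->
  exists x p q, [/\ U x, A p, B q, closure (connected_component U x) p &
    closure (connected_component U x) q].
Proof.
move=> oU cA cB [a Aa] [b Bb] AB UAB.
pose g := segment_path a b.
have cg : continuous g by exact: segment_path_continuous.
have [_ _ g0 g1] := @segment_path_from_to R setT a b (fun=> I).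
have AnB z : A z -> B z -> False by move=> Az Bz; rewrite -[False]/(set0 z) -AB.
have cgA : closed (g @^-1` A) by apply: preimage_closed => // t _; exact: cg.
have cgB : closed (g @^-1` B) by apply: preimage_closed => // t _; exact: cg.
have cid (S : set R) : {within S, continuous (@idfun R)}.
  by apply: continuous_subspaceT => t; exact: cvg_id.
have I0 : `[(0 : R), 1]%classic 0 by rewrite /= in_itv /= lexx ler01.
have [||s] := @compact_EVT_max _ R idfun (`[0, 1] `&` g @^-1` A) _ _ (cid _).
- by exists 0; split => //; rewrite /g /= g0.
- by apply: compact_closedI => //; exact: segment_compact.
rewrite inE => -[/=]; rewrite in_itv /= => /andP[s0 s1] As smax.
have sB : ~ B (g s) by exact: AnB.
have [||t] := @compact_EVT_min _ R idfun (`[s, 1] `&` g @^-1` B) _ _ (cid _).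
- by exists 1; split => /=; [rewrite in_itv /= s1 lexx|rewrite /g g1].
- by apply: compact_closedI => //; exact: segment_compact.
rewrite inE => -[/=]; rewrite in_itv /= => /andP[st t1] Bt tmin.
have lst : s < t.
  by rewrite lt_neqAle st andbT; apply: contra_notN sB => /eqP ->.
have IU u : s < u < t -> U (g u).
  move=> /andP[su ut]; apply: contrapT => Ugu.
  have : (~` U) (g u) by []; rewrite UAB => -[Agu|Bgu].
    have /smax /= : u \in `[0, 1] `&` g @^-1` A.
      rewrite inE; split => //=; rewrite in_itv /=; apply/andP; split; lra.
    by lra.
  have /tmin /= : u \in `[s, 1] `&` g @^-1` B.
    rewrite inE; split => //=; rewrite in_itv /=; apply/andP; split; lra.
  by lra.
pose m := (s + t) / 2.
have mI : s < m < t by rewrite /m; apply/andP; split; lra.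
have sub u : s < u < t -> connected_component U (g m) (g u).
  move=> hu; have cI : connected (`]s, t[%classic : set R).
    by apply/connected_intervalP; exact: interval_is_interval.
  have := connected_component_max _ _ (@segment_path_connected a b _ cI).
  apply.
  - by exists m.
  - by move=> _ [v /= + <-]; rewrite in_itv /=; exact: IU.
  - by exists u.
exists (g m), (g s), (g t); split => //; first exact: IU.
- move=> W /cg /nbhs_ballP[e /= e0 hW].
  (* A parameter strictly after [s], still in the open interval and within [e] of [s], so that [g u]
     is a point of the component close to [g s]. *)
  pose u := Num.min (s + e / 2) m.
  have us : s < u by rewrite lt_min; apply/andP; split; lra.
  have [u1 u2] : u <= s + e / 2 /\ u <= m by split; rewrite ge_min lexx ?orbT.
  exists (g u); split; first by apply: sub; lra.
  by apply: hW; rewrite -ball_normE /= distrC ger0_norm; lra.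
- move=> W /cg /nbhs_ballP[e /= e0 hW].
  pose u := Num.max (t - e / 2) m.
  have us : u < t by rewrite gt_max; apply/andP; split; lra.
  have [u1 u2] : t - e / 2 <= u /\ m <= u by split; rewrite le_max lexx ?orbT.
  exists (g u); split; first by apply: sub; lra.
  by apply: hW; rewrite -ball_normE /= ger0_norm; lra.
Qed.

Lemma connected_setC_open U : open U ->
  (forall z, U z -> bounded_set (connected_component U z)) ->
  (forall z, U z -> simply_connected (connected_component U z)) ->
  connected (~` U).
Proof.
move=> oU bU sU A A0 [W oW AO] [F cF AF]; apply: contrapT => AU.
have cA : closed A by rewrite AF; apply: closedI => //; exact: open_closedC.
pose B := ~` U `&` ~` W.
have cB : closed B by apply: closedI; exact: open_closedC.
have UAB : ~` U = A `|` B by rewrite AO /B -setIUr setUv setIT.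
have AB : A `&` B = set0.
  by rewrite AO /B -subset0 => z [[_ Wz] [_ nWz]]; exact: nWz.
have B0 : B !=set0.
  apply/set0P/eqP => B0; apply: AU.
  by rewrite UAB B0 setU0.
have [x [p [q [Ux Ap Bq clp clq]]]] :=
  component_between U A B oU cA cB A0 B0 AB UAB.
have AnU z : A z -> ~ U z by rewrite AO => -[].
have BnU z : B z -> ~ U z by move=> [].
have subU := @connected_component_sub _ U x.
apply: (@closure_boundary_connected R (connected_component U x) A B p q) => //.
- exact: component_open.
- exact: component_connected.
- by apply: path_from_to_component; have [] := sU x Ux.
- by apply: simply_connected_loops; exact: sU.
- exact: bU.
- move=> z clz; have [Uz|nUz] := pselect (U z).
    by constructor 1; exact: closure_component.
  have : (~` U) z by []; by rewrite UAB => -[h|h]; [constructor 2|constructor 3].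
- by move=> /subU; exact: AnU.
- by move=> /subU; exact: BnU.
Qed.

End Components.

Theorem theorem2p12 (R : realType) (G : set (C R -> C R))
  (hG : transcendental_semigroup G)
  (hbounded : forall z : C R, fatou_set G z ->
     bounded_set (connected_component (fatou_set G) z))
  (hsimply : forall z : C R, fatou_set G z ->
     simply_connected (connected_component (fatou_set G) z)) :
  connected (julia_set G).
Proof.
apply: connected_setC_open => //.
by apply: bigcup_open => U [].
Qed.
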